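(* Fix $n\in\mathbb{N}$. (1) The number of subsets of $\{1,2,\ldots,n\}$ that contain $n$ and whose difference sets contain only odd numbers is $F_{n+1}$. (2) The number of subsets of $\{1,2,\ldots,n\}$ whose difference sets contain only odd numbers is $F_{n+3}-1$. Here the empty set and sets with exactly one element are regarded as vacuously satisfying the requirement that the difference set contain only odd numbers.
   Context: $\mathbb{N}=\{1,2,3,\ldots\}$. For a set $A=\{a_1,a_2,\ldots,a_k\}$ of natural numbers with $a_1<a_2<\cdots<a_k$ and $k\ge 2$, the difference set of $A$ is $\{a_2-a_1,a_3-a_2,\ldots,a_k-a_{k-1}\}$ (differences of consecutive elements only). The empty set and a set with exactly one element do not have a difference set. The Fibonacci sequence is defined by $F_{-1}=1$, $F_0=0$, and $F_m=F_{m-1}+F_{m-2}$ for all $m\ge 1$. *)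

(* Defs.v *)
From HB Require Import structures.
From mathcomp Require Import all_boot.
From mathcomp Require Import finmap.

Set Implicit Arguments.
Unset Strict Implicit.
Unset Printing Implicit Defensive.

Local Open Scope nat_scope.
Local Open Scope fset_scope.

(* [fib_from_m1 k] is F_(k-1): the sequence started at F_(-1) = 1, F_0 = 0. *)
Fixpoint fib_from_m1 (k : nat) : nat :=
  match k with
  | 0 => 1
  | 1 => 0
  | (k''.+1 as k').+1 => fib_from_m1 k' + fib_from_m1 k''
  end.

Definition fib (m : nat) : nat := fib_from_m1 m.+1.

Definition initial_segment (n : nat) : {fset nat} := [fset i in iota 1 n].

Definition increasing_enum (A : {fset nat}) : seq nat := sort leq A.

(* Differences of consecutive elements only. For #|` A| < 2, where the
   difference set is undefined, this is the junk value fset0. *)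
Definition difference_set (A : {fset nat}) : {fset nat} :=
  let a := nth 0 (increasing_enum A) in
  [fset a i.+1 - a i | i in iota 0 (#|` A|).-1].

Definition odd_difference_set (A : {fset nat}) : bool :=
  (2 <= #|` A|) ==> all odd (difference_set A).

(* Main.v *)
(** A set has only odd consecutive differences iff the parities of its
    elements alternate in increasing order. Appending [n.+1] to such a subset
    [A] of {1,...,n} preserves this iff [A] is empty or its maximum has the
    parity of [n]. So let [Q n m] count the subsets of {1,...,n} whose increasing
    enumeration, followed by a number [m] (of which only the parity matters),
    alternates in parity. Splitting on the membership of [n.+1] gives
    [Q n.+1 n.+2 = Q n n + Q n n.+1] and [Q n.+1 n.+1 = Q n n.+1], hence
    [Q n n.+1 = F_(n+2)]; this counts the subsets in (1) for [n.+1], and summing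
    gives (2). *)
Require Import Defs.
From HB Require Import structures.
From mathcomp Require Import all_boot.
From mathcomp Require Import finmap.

Local Open Scope nat_scope.
Local Open Scope fset_scope.

(** Split on whether a subset contains [x]: inserting [x] is injective on the subsets of [S] because
    [x] lies outside [S]. *)
Lemma card_fpowerset_fsetU1 (K : choiceType) (x : K) (S : {fset K})
    (P : pred {fset K}) : x \notin S ->
  #|` [fset A in fpowerset (x |` S) | P A]| =
  (#|` [fset A in fpowerset S | P A]| +
   #|` [fset A in fpowerset S | P (x |` A)]|)%N.
Proof.
move=> xS.
have injU : {in [fset A in fpowerset S | P (x |` A)] &,
    injective (fun A : {fset K} => x |` A)}.
  have xN A : A \in [fset A in fpowerset S | P (x |` A)] -> x \notin A.
    rewrite !inE /= fpowersetE => /andP[/fsubsetP AS _].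
    by apply: contra xS => /AS.
  by move=> A B /xN xA /xN xB eqAB; rewrite -(fsetU1K xA) eqAB fsetU1K.
(* The sum of two cardinals becomes that of a union plus that of an intersection; the latter is
   empty, as no subset of [S] contains [x]. *)
rewrite -(card_in_imfset imfset_key injU) -cardfsUI.
rewrite [X in (_ + X)%N](_ : _ = 0) ?addn0.
  congr #|` _|; apply/fsetP => A; apply/idP/idP.
    rewrite !inE /= !fpowersetE => /andP[AxS PA].
    have [xA|xA] := boolP (x \in A).
      apply/orP; right; apply/imfsetP; exists (A `\ x); last by rewrite fsetD1K.
      by rewrite !inE /= fpowersetE fsetD1K // PA andbT fsubDset.
    rewrite PA andbT; apply/orP; left; apply/fsubsetP => y yA.
    move/fsubsetP/(_ y yA): AxS; rewrite !inE => /orP[/eqP eyx|//].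
    by rewrite -eyx yA in xA.
  rewrite !inE /= !fpowersetE => /orP[/andP[AS ->]|].
    by rewrite andbT (fsubset_trans AS) // fsubsetU1.
  case/imfsetP => B; rewrite !inE /= fpowersetE => /andP[BS PB] ->.
  by rewrite PB andbT fsetUS.
apply/eqP; rewrite cardfs_eq0; apply/eqP/fsetP => A; rewrite !inE.
apply/negP => /andP[/andP[]]; rewrite /= fpowersetE => /fsubsetP AS _.
case/imfsetP => B _ eAB; move/negP: xS; apply; apply: AS.
by rewrite eAB fset1U1.
Qed.

Lemma in_initial_segment (n i : nat) :
  (i \in initial_segment n) = (0 < i <= n).
Proof. by rewrite in_fset mem_iota add1n ltnS. Qed.

Lemma initial_segmentS (n : nat) :
  initial_segment n.+1 = n.+1 |` initial_segment n.
Proof.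
apply/fsetP => i; rewrite in_fset1U !in_initial_segment (leq_eqVlt i) ltnS.
by case: eqP => [->|].
Qed.

Lemma initial_segmentSn (n : nat) : n.+1 \notin initial_segment n.
Proof. by rewrite in_initial_segment ltnn. Qed.

(** Since [n.+1] exceeds every element of [A], both sides are sorted, and they are permutations of
    each other. *)
Lemma increasing_enum_fsetU1 (n : nat) (A : {fset nat}) :
  A `<=` initial_segment n ->
  increasing_enum (n.+1 |` A) = rcons (increasing_enum A) n.+1.
Proof.
move=> /fsubsetP An.
have leAn i : i \in A -> i <= n.
  by move/An; rewrite in_initial_segment => /andP[].
have nA : n.+1 \notin A by apply: contra (initial_segmentSn n) => /An.
apply: (sorted_eq leq_trans anti_leq); rewrite ?(sort_sorted leq_total) //.
  rewrite /increasing_enum -cats1 (sorted_pairwise leq_trans) pairwise_cat /=.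
  rewrite -(sorted_pairwise leq_trans) (sort_sorted leq_total) !andbT.
  apply/allrelP => i j; rewrite mem_sort inE => iA /eqP ->.
  by rewrite leqW // leAn.
rewrite perm_sort; apply: uniq_perm => [||i]; rewrite ?fset_uniq //.
  by rewrite rcons_uniq mem_sort nA sort_uniq fset_uniq.
by rewrite mem_rcons !inE mem_sort.
Qed.

Definition alternating : pred (seq nat) := sorted (fun i j => odd i != odd j).

Lemma odd_difference_setE (A : {fset nat}) :
  odd_difference_set A = alternating (increasing_enum A).
Proof.
rewrite /odd_difference_set /alternating /difference_set.
have szA : size (increasing_enum A) = #|` A| by rewrite size_sort.
set s := increasing_enum A in szA *.
(* Sortedness keeps the natural-number subtraction from truncating, so the parity of a difference
   can be read off its two terms. *)
have leS i : i.+1 < size s -> nth 0 s i <= nth 0 s i.+1.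
  by move=> lis; move/sortedP: (sort_sorted leq_total A); apply.
have oddS i : i.+1 < size s ->
    odd (nth 0 s i.+1 - nth 0 s i) = (odd (nth 0 s i) != odd (nth 0 s i.+1)).
  by move=> lis; rewrite oddB ?leS // addbC negb_eqb.
(* A consecutive pair at index [i] already forces two elements, which discharges the cardinality
   guard. *)
apply/implyP/(sortedP 0) => [+ i lis|alt leA].
  rewrite -szA (leq_trans _ lis) // => /(_ isT) /allP oddA.
  rewrite -oddS //; apply: oddA; apply/imfsetP; exists i => //=.
  by rewrite mem_iota /=; case: (size s) lis.
apply/allP => _ /imfsetP[i /= + ->]; rewrite mem_iota -szA add0n => /= li.
have lis : i.+1 < size s by case: (size s) li.
by rewrite oddS // alt.
Qed.

Lemma alternating_rcons2 (s : seq nat) (i j : nat) :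
  alternating (rcons (rcons s i) j) =
  alternating (rcons s i) && (odd i != odd j).
Proof.
rewrite /alternating; case: s => [|k s] /=; first by rewrite andbT.
by rewrite [in LHS]rcons_path last_rcons.
Qed.

Lemma alternating_rcons_parity (s : seq nat) (i j : nat) :
  odd i = odd j -> alternating (rcons s i) = alternating (rcons s j).
Proof.
by move=> eij; case: s => //= k s; rewrite /alternating /= !rcons_path eij.
Qed.

Lemma eq_card_fpowerset (K : choiceType) (S : {fset K}) (P Q : pred {fset K}) :
  (forall A, A `<=` S -> P A = Q A) ->
  #|` [fset A in fpowerset S | P A]| = #|` [fset A in fpowerset S | Q A]|.
Proof.
move=> eqPQ; congr #|` _|; apply/fsetP => A; rewrite !inE /= fpowersetE.
by case: (boolP (A `<=` S)) => //= /eqPQ.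
Qed.

(** This is [Q n m] of the overview. *)
Definition alternating_count (n m : nat) : nat :=
  #|` [fset A in fpowerset (initial_segment n) |
         alternating (rcons (increasing_enum A) m)]|.

Lemma alternating_count_parity (n i j : nat) :
  odd i = odd j -> alternating_count n i = alternating_count n j.
Proof.
by move=> eij; apply: eq_card_fpowerset => A _; apply: alternating_rcons_parity.
Qed.

Lemma card_fpowerset_initial_segment0 (P : pred {fset nat}) :
  #|` [fset A in fpowerset (initial_segment 0) | P A]| = P fset0.
Proof.
have -> : initial_segment 0 = fset0.
  by apply/fsetP => i; rewrite in_initial_segment; case: i.
rewrite fpowerset0; case: (boolP (P fset0)) => P0.
  rewrite (_ : [fset A in _ | _] = [fset fset0]) ?cardfs1 //.
  by apply/fsetP => A; rewrite !inE /= ?inE andb_idr // => /eqP ->.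
apply/eqP; rewrite cardfs_eq0; apply/eqP/fsetP => A; rewrite !inE /= ?inE.
by apply/negP => /andP[/eqP ->]; apply/negP.
Qed.

Lemma increasing_enum0 : increasing_enum fset0 = [::].
Proof. by apply: size0nil; rewrite size_sort cardfs0. Qed.

Lemma alternating_count0 (m : nat) : alternating_count 0 m = 1.
Proof.
by rewrite /alternating_count card_fpowerset_initial_segment0 increasing_enum0.
Qed.

(** The second summand comes from the subsets containing [n.+1]: there [n.+1] precedes [m], so their
    parities must differ, that is, [n] and [m] must agree in parity. *)
Lemma alternating_countS (n m : nat) :
  alternating_count n.+1 m =
  (alternating_count n m + (odd n == odd m) * alternating_count n n.+1)%N.
Proof.
rewrite {1}/alternating_count initial_segmentS.
rewrite card_fpowerset_fsetU1 ?initial_segmentSn //; congr (_ + _)%N.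
rewrite (@eq_card_fpowerset _ _ _ (fun A =>
  alternating (rcons (increasing_enum A) n.+1) && (odd n == odd m))); last first.
  move=> A An; rewrite increasing_enum_fsetU1 // alternating_rcons2 /=.
  by case: (odd n); case: (odd m).
case: (odd n == odd m); rewrite ?mul1n ?mul0n.
  by apply: eq_card_fpowerset => A _; rewrite andbT.
by apply/eqP; rewrite cardfs_eq0; apply/eqP/fsetP => A; rewrite !inE andbF andbF.
Qed.

Lemma fibSS (n : nat) : fib n.+2 = (fib n.+1 + fib n)%N.
Proof. by []. Qed.

(** Both values go through one induction, because the recursion for the first also calls the second,
    [n.+2] having the parity of [n]. *)
Lemma alternating_count_fib (n : nat) :
  alternating_count n n.+1 = fib n.+2 /\ alternating_count n n = fib n.+1.
Proof.
elim: n => [|n [IH1 IH0]]; first by rewrite !alternating_count0.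
rewrite !alternating_countS /= negbK eqxx mul1n IH1; split; last first.
  by case: (odd n); rewrite addn0.
rewrite (@alternating_count_parity n n.+2 n) /= ?negbK //.
by rewrite IH0 addnC -fibSS.
Qed.

Lemma card_odd_difference_setU1 (n : nat) :
  #|` [fset A in fpowerset (initial_segment n) | odd_difference_set (n.+1 |` A)]|
  = fib n.+2.
Proof.
have [<- _] := alternating_count_fib n; apply: eq_card_fpowerset => A An.
by rewrite odd_difference_setE increasing_enum_fsetU1.
Qed.

(** The successor replaces the subtraction of 1, so that the induction step is exactly the Fibonacci
    recurrence. *)
Lemma card_odd_difference_set (n : nat) :
  #|` [fset A in fpowerset (initial_segment n) | odd_difference_set A]|.+1
  = fib n.+3.
Proof.
elim: n => [|n IH].
  by rewrite card_fpowerset_initial_segment0 odd_difference_setE increasing_enum0.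
rewrite initial_segmentS card_fpowerset_fsetU1 ?initial_segmentSn //.
by rewrite -addSn IH card_odd_difference_setU1 -fibSS.
Qed.

Theorem theorem8 (n : nat) (hn : 0 < n) :
  #|` [fset A in fpowerset (initial_segment n) |
         (n \in A) && odd_difference_set A]| = fib (n + 1)
  /\
  #|` [fset A in fpowerset (initial_segment n) |
         odd_difference_set A]| = fib (n + 3) - 1.
Proof.
split; last by rewrite addn3 -card_odd_difference_set subn1.
case: n hn => // n _; rewrite addn1 -card_odd_difference_setU1.
rewrite initial_segmentS card_fpowerset_fsetU1 ?initial_segmentSn //.
(* The first summand counts subsets of [initial_segment n] that contain [n.+1]; there are none. *)
rewrite [X in (X + _)%N](_ : _ = 0) ?add0n.
  by apply: eq_card_fpowerset => A _; rewrite fset1U1.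
apply/eqP; rewrite cardfs_eq0; apply/eqP/fsetP => A; rewrite !inE /= fpowersetE.
apply/negP => /andP[/fsubsetP An /andP[nA _]].
by move/negP: (initial_segmentSn n); apply; apply: An.
Qed.
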